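(* Let $d \ge 2$ be an integer, let $0 < p < \bar m \le 1$, and let $(q_t)_{t \ge 0}$ be the discrete-time Markov chain on $\mathbb{N}^d$ (with $0 \in \mathbb{N}$) describing a batch of $d$ synchronized queues with i.i.d. Bernoulli($p$) arrivals and Bernoulli($\bar m$) service success, operated under the policy that activates service whenever possible, i.e. $$q_{t+1} = q_t - \mathbf{1}\, m_t v_t + a_t, \qquad v_t = \begin{cases} 1 & \text{if } q_t \ge \mathbf{1} \text{ componentwise},\\ 0 & \text{otherwise.}\end{cases}$$ Then $(q_t)$ is null-recurrent (the batch is ''quasi-stable'') if $d \in \{2,3\}$, and $(q_t)$ is transient (the batch is ''unstable'') if $d \ge 4$.
   Context: $\mathbf{1} = (1,\dots,1)^\top \in \mathbb{N}^d$ is the all-ones vector. The vector $q_t \in \mathbb{N}^d$ lists the numbers of customers in the $d$ queues at time slot $t$. The arrival vectors $a_t = (a_t^{(1)},\dots,a_t^{(d)}) \in \{0,1\}^d$ consist of $d$ i.i.d. Bernoulli processes: all $a_t^{(i)}$ ($t \ge 0$, $1 \le i \le d$) are independent with $\mathbb{P}[a_t^{(i)} = 1] = p$. The variables $m_t \in \{0,1\}$, $t \ge 0$, are i.i.d. with $\mathbb{P}[m_t = 1] = \bar m$, and are independent of the arrivals. The control $v_t \in \{0,1\}$ must satisfy $\mathbf{1} v_t \le q_t$ (service removes one customer from every queue simultaneously and is impossible if some queue is empty); the policy considered sets $v_t = 1$ exactly when this is allowed. The variables $a_t, m_t$ are independent of $q_0, \dots, q_t$. The state $0 \in \mathbb{N}^d$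 is accessible from every state. The chain is called null-recurrent if the state $0$ (equivalently, every state in its communicating class) is recurrent with infinite expected return time, and transient if the state $0$ is transient. *)

(* Defs.v *)
From HB Require Import structures.
From mathcomp Require Import all_boot all_order all_algebra.
From mathcomp Require Import all_classical all_reals all_analysis.

Set Implicit Arguments.
Unset Strict Implicit.
Unset Printing Implicit Defensive.

Import Order.TTheory GRing.Theory Num.Theory.

Local Open Scope classical_set_scope.
Local Open Scope ring_scope.
Local Open Scope ereal_scope.

Definition mutually_independent (disp disp' : measure_display)
    (T : measurableType disp) (T' : measurableType disp') (R : realType)
    (P : probability T R) (I : eqType) (X : I -> {RV P >-> T'}) : Prop :=
  forall (J : seq I) (B : I -> set T'),
    uniq J -> (forall i, i \in J -> measurable (B i)) ->
    P (\bigcap_(i in [set` J]) (X i @^-1` B i)) =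
    \prod_(i <- J) P (X i @^-1` B i).

(* Stationary Markov chains are given as families [q], where [q x t] is the
   state at time [t] of the chain started from the deterministic state [x], so
   that probabilities of events on [q x] are taken under the law usually
   written P_x. *)
Section MarkovChain.
Context (disp : measure_display) (T : measurableType disp) (R : realType).
Variables (P : probability T R) (S : Type) (q : S -> nat -> T -> S).

(* +oo if the chain started from x never returns to x. *)
Definition return_time (x : S) (w : T) : \bar R :=
  ereal_inf [set t%:R%:E | t in [set t : nat | (0 < t)%N /\ q x t w = x]].

Definition recurrent (x : S) : Prop :=
  P [set w | return_time x w < +oo] = 1.

Definition transient (x : S) : Prop :=
  P [set w | return_time x w < +oo] < 1.

Definition null_recurrent (x : S) : Prop :=
  recurrent x /\ \int[P]_w return_time x w = +oo.

End MarkovChain.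

Definition qstate (d : nat) : Type := {ffun 'I_d -> nat}.

Definition empty_queues (d : nat) : qstate d := [ffun=> 0%N].

Definition service_allowed (d : nat) (x : qstate d) : bool :=
  [forall i, (1 <= x i)%N].

(* The subtraction never truncates: the subtracted term is nonzero only if all
   the coordinates of x are positive. *)
Definition batch_step (d : nat) (x : qstate d) (m : bool)
    (a : 'I_d -> bool) : qstate d :=
  [ffun i => (x i - m * service_allowed x + a i)%N].

Section Batch.
Context (disp : measure_display) (T : measurableType disp) (R : realType).
Variables (P : probability T R) (d : nat).
Variables (a : nat -> 'I_d -> {RV P >-> bool}) (m : nat -> {RV P >-> bool}).

Fixpoint batch (x : qstate d) (t : nat) (w : T) : qstate d :=
  if t is t'.+1
  then batch_step (batch x t' w) (m t' w) (fun i => a t' i w)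
  else x.

(* All the arrivals and all the service outcomes as one family: the index
   (t, Some i) stands for a_t^(i) and (t, None) for m_t. *)
Definition arrivals_services (k : nat * option 'I_d) : {RV P >-> bool} :=
  if k.2 is Some i then a k.1 i else m k.1.

End Batch.

(* Main.v *)
Require Import Defs.
From mathcomp Require Import all_boot all_order all_algebra.
From mathcomp Require Import all_classical all_reals all_analysis.
From mathcomp Require Import measurable_realfun.
From mathcomp Require Import ring lra zify.

(* Let v_n = P(q_n = 0), r_n = P(no return to 0 by time n), and let u_n be the
   probability that all queues have received equally many arrivals by time n,
   i.e. the return probability of the (d-1)-dimensional walk of queue
   differences. Decomposing at the last visit to 0 gives
   \sum_(j <= n) r_j v_(n-j) = 1, so the chain is recurrent if \sum v diverges,
   transient if \sum v converges, and has infinite mean return time if v -> 0.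

   Upper bound: v_n <= u_n = \sum_k b_n(k)^d with b_n the binomial mass function.
   If E_n is the Dirichlet energy of b_n, then p(1-p) E_n is the decrement of
   \sum_k b_n(k)^2 from n to n+1, so \sum_n E_n is finite, while Nash's
   inequality gives (max b_n)^3 <= 4 E_n. Hence u_n -> 0 for d >= 2 and \sum u
   converges for d >= 4.

   Lower bound: for d <= 3, Chebyshev's inequality gives u_n >= c/n. When the
   arrivals are balanced all queues have a common length, which is at most the
   excess of arrivals over services since the last time some queue was empty;
   as p < mbar this excess has bounded exponential moments, and conditioning on
   balance costs at most u_s for the time s up to which the past is summed, by
   AM-GM. So with L large at least half of \sum u comes from times when all
   queues have equal length at most L, from which L steps without arrivals and
   with successful service lead to 0. *)

Set Implicit Arguments.
Unset Strict Implicit.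
Unset Printing Implicit Defensive.

Import Order.TTheory GRing.Theory Num.Theory.

Local Open Scope ring_scope.

(** * The binomial mass function *)

Section Binomial.
Variables (R : realFieldType) (p : R).
Hypotheses (p_gt0 : 0 < p) (p_lt1 : p < 1).

(** Expectation under the binomial law with parameters [n] and [p], encoded by conditioning on one
    trial, so that no binomial coefficient appears. *)
Fixpoint binomial_expect n (f : nat -> R) : R :=
  if n is n'.+1
  then (1 - p) * binomial_expect n' f + p * binomial_expect n' (fun k => f k.+1)
  else f 0%N.

Definition binomial_mass n k : R := binomial_expect n (fun j => (j == k)%:R).

Local Notation b := binomial_mass.

Definition shifted_mass n k : R := if k is k'.+1 then b n k' else 0.

Local Notation b' := shifted_mass.

Lemma eq_binomial_expect n f g : f =1 g -> binomial_expect n f = binomial_expect n g.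
Proof.
elim: n f g => [|n IH] f g fg /=; first exact: fg.
congr (_ * _ + _ * _); apply: IH => k; exact: fg.
Qed.

Lemma binomial_massS n k : b n.+1 k = (1 - p) * b n k + p * b' n k.
Proof.
rewrite /b' /binomial_mass /=; congr (_ + _ * _); case: k => [|k] //.
by elim: n => //= n ->; ring.
Qed.

Lemma binomial_mass_ge0 n k : 0 <= b n k.
Proof.
elim: n k => [|n IH] k; first by rewrite /binomial_mass /= ler0n.
rewrite binomial_massS addr_ge0 // mulr_ge0 ?subr_ge0 ?IH ?(ltW p_gt0) ?(ltW p_lt1) //.
by case: k => [|k] /=; [exact: lexx|exact: IH].
Qed.

Lemma binomial_mass_eq0 n k : (n < k)%N -> b n k = 0.
Proof.
elim: n k => [|n IH] [|k] //=; rewrite ltnS => nk.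
by rewrite binomial_massS /= !IH ?(leqW nk) // !mulr0 addr0.
Qed.

Lemma sum_shifted_mass n N (F : nat -> R -> R) : (forall k, F k 0 = 0) ->
  \sum_(k < N.+1) F k (b' n k) = \sum_(k < N) F k.+1 (b n k).
Proof. by move=> F0; rewrite big_ord_recl /= F0 add0r. Qed.

Lemma widen_sum_mass n N (F : nat -> R -> R) : (forall k, F k 0 = 0) ->
  (n < N)%N -> \sum_(k < N) F k (b n k) = \sum_(k < n.+1) F k (b n k).
Proof.
move=> F0 nN.
rewrite -[RHS](big_mkord xpredT (fun k => F k (b n k))) /=.
rewrite -[LHS](big_mkord xpredT (fun k => F k (b n k))) /=.
rewrite (big_cat_nat (leq0n _) nN) //= [X in _ + X]big1_seq ?addr0 // => k /=.
by rewrite mem_index_iota => /andP[nk _]; rewrite binomial_mass_eq0.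
Qed.

Lemma binomial_expect_sum n N f : (n < N)%N ->
  binomial_expect n f = \sum_(k < N) b n k * f k.
Proof.
elim: n N f => [|n IH] [|N] // f nN.
  rewrite big_ord_recl /= big1 ?addr0 ?mul1r // => i _.
  by rewrite binomial_mass_eq0 ?mul0r.
rewrite /= (IH N.+1 f) ?(IH N (fun k => f k.+1)) ?leqW //.
rewrite -(@sum_shifted_mass n N (fun k x => x * f k)); last by move=> k; rewrite mul0r.
rewrite !mulr_sumr -big_split; apply: eq_bigr => k _ /=.
by rewrite binomial_massS; ring.
Qed.

Lemma binomial_expect_cst n c : binomial_expect n (fun=> c) = c.
Proof. by elim: n => //= n ->; ring. Qed.

Lemma sum_binomial_mass n N : (n < N)%N -> \sum_(k < N) b n k = 1.
Proof.
move=> nN; rewrite -[RHS](binomial_expect_cst n) (binomial_expect_sum _ nN).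
by apply: eq_bigr => k _; rewrite mulr1.
Qed.

Lemma binomial_mass_le1 n k : b n k <= 1.
Proof.
have kN : (k < (maxn n k).+1)%N by rewrite ltnS leq_maxr.
rewrite -(@sum_binomial_mass n (maxn n k).+1) ?ltnS ?leq_maxl //.
rewrite (bigD1 (Ordinal kN)) //= lerDl sumr_ge0 // => i _.
exact: binomial_mass_ge0.
Qed.

(** The range [n.+2] contains the supports of [b n] and of its shift, so this is the full Dirichlet
    energy. *)
Definition mass_energy n : R := \sum_(k < n.+2) (b n k - b' n k) ^+ 2.

Lemma mass_energy_ge0 n : 0 <= mass_energy n.
Proof. by apply: sumr_ge0 => k _; exact: sqr_ge0. Qed.

(** [b n.+1] is a convex combination of [b n] and its shift, which have equal sums of squares; the
    defect in the convexity of the square is [p (1 - p)] times the squared difference. *)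
Lemma sum_sqr_massS n :
  \sum_(k < n.+2) b n.+1 k ^+ 2 =
  \sum_(k < n.+1) b n k ^+ 2 - p * (1 - p) * mass_energy n.
Proof.
have F0 (k : nat) : (0 : R) ^+ 2 = 0 by rewrite expr0n.
rewrite -[X in X - _](_ : (1 - p) * \sum_(k < n.+2) b n k ^+ 2
    + p * \sum_(k < n.+2) b' n k ^+ 2 = _); last first.
  rewrite (@sum_shifted_mass n n.+1 (fun _ x => x ^+ 2)) //.
  by rewrite (@widen_sum_mass n n.+2 (fun _ x => x ^+ 2)) //; ring.
rewrite !mulr_sumr -big_split /= -sumrB; apply: eq_bigr => k _.
by rewrite binomial_massS; ring.
Qed.

Lemma sum_mass_energy N : \sum_(n < N) mass_energy n <= (p * (1 - p))^-1.
Proof.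
have pq0 : 0 < p * (1 - p) by rewrite mulr_gt0 ?subr_gt0.
rewrite -[leRHS]mul1r ler_pdivlMr // mulrC.
suff -> : p * (1 - p) * \sum_(n < N) mass_energy n =
    1 - \sum_(k < N.+1) b N k ^+ 2.
  by rewrite gerBl sumr_ge0 // => k _; exact: sqr_ge0.
elim: N => [|N IH].
  by rewrite big_ord0 big_ord1 /binomial_mass /=; ring.
by rewrite big_ord_recr /= mulrDr IH sum_sqr_massS; ring.
Qed.

Definition max_mass n : R := b n [arg max_(k > ord0 : 'I_n.+1) b n k]%O.

Lemma binomial_mass_le_max n k : b n k <= max_mass n.
Proof.
rewrite /max_mass; case: arg_maxP => //= i _ imax.
have [kn|nk] := ltnP k n.+1; first exact: (imax (Ordinal kn)).
by rewrite binomial_mass_eq0 // binomial_mass_ge0.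
Qed.

Lemma max_mass_ge0 n : 0 <= max_mass n.
Proof. exact: binomial_mass_ge0. Qed.

Lemma max_mass_gt0 n : 0 < max_mass n.
Proof.
rewrite lt_neqAle max_mass_ge0 andbT eq_sym; apply/eqP => m0.
have := sum_binomial_mass (ltnSn n); rewrite big1 => [/eqP|k _].
  by rewrite eq_sym oner_eq0.
by apply/eqP; rewrite eq_le binomial_mass_ge0 andbT -m0 binomial_mass_le_max.
Qed.

Lemma sqr_mass_telescope n k :
  b n k ^+ 2 = \sum_(j < k.+1) (b n j ^+ 2 - b' n j ^+ 2).
Proof.
elim: k => [|k IH]; first by rewrite big_ord1 /= expr0n subr0.
by rewrite big_ord_recr /= -IH addrC subrK.
Qed.

(* Nash's inequality for [b n]: with [s] the maximum of [b n], telescoping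
   [b n k ^+ 2] and applying AM-GM with weight [4 / s] to each increment gives
   [s ^+ 2 <= 2 E / s + s / 2 * \sum_k b n k ^+ 2]. *)
Lemma max_mass_energy n : max_mass n ^+ 3 <= 4 * mass_energy n.
Proof.
have s0 := max_mass_gt0 n; set s := max_mass n in s0 *.
have F0 (k : nat) : (0 : R) ^+ 2 = 0 by rewrite expr0n.
have sqr_le : \sum_(k < n.+1) b n k ^+ 2 <= s.
  rewrite -[leRHS]mulr1 -(sum_binomial_mass (ltnSn n)) mulr_sumr.
  by apply: ler_sum => k _; rewrite expr2 ler_wpM2r ?binomial_mass_ge0 ?binomial_mass_le_max.
(* As the squares sum to at most [s], the last term is at most [s ^+ 3 / 2] and is absorbed on the
   left. *)
suff key : s ^+ 2 * s <= 2 * mass_energy n + s ^+ 2 / 2 * \sum_(k < n.+1) b n k ^+ 2.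
  have : s ^+ 2 / 2 * \sum_(k < n.+1) b n k ^+ 2 <= s ^+ 2 / 2 * s.
    by rewrite ler_wpM2l // divr_ge0 ?sqr_ge0.
  by clear F0; rewrite exprSr; lra.
have [k sE kn] : exists2 k, s = b n k & (k < n.+1)%N.
  by rewrite /s /max_mass; case: arg_maxP => //= i _ _; exists i.
rewrite {1}sE sqr_mass_telescope.
have -> : s ^+ 2 / 2 * \sum_(k < n.+1) b n k ^+ 2 =
    \sum_(k < n.+2) s ^+ 2 / 4 * (b n k ^+ 2 + b' n k ^+ 2).
  rewrite -mulr_sumr big_split /= (@sum_shifted_mass n n.+1 (fun _ x => x ^+ 2)) //.
  by rewrite (@widen_sum_mass n n.+2 (fun _ x => x ^+ 2)) //; field.
rewrite /mass_energy mulr_sumr -big_split mulr_suml /=.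
pose F j := 2 * (b n j - b' n j) ^+ 2 + s ^+ 2 / 4 * (b n j ^+ 2 + b' n j ^+ 2).
have FE j : (b n j ^+ 2 - b' n j ^+ 2) * s <= F j.
  have -> : F j = (b n j ^+ 2 - b' n j ^+ 2) * s +
     (2 * (b n j - b' n j - s / 4 * (b n j + b' n j)) ^+ 2
      + s ^+ 2 / 8 * (b n j - b' n j) ^+ 2) by rewrite /F; field.
  rewrite lerDl; apply: addr_ge0; apply: mulr_ge0; rewrite ?sqr_ge0 ?ler0n //.
  by rewrite divr_ge0 ?sqr_ge0.
have kn2 : (k.+1 <= n.+2)%N by exact: leqW.
apply: (@le_trans _ _ (\sum_(j < k.+1) F j)); first by apply: ler_sum => j _.
rewrite -(big_mkord xpredT F) -(big_mkord xpredT (fun j => F j)).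
rewrite (big_cat_nat (leq0n _) kn2) //=.
rewrite lerDl sumr_ge0 // => j _.
apply: addr_ge0; apply: mulr_ge0; rewrite ?addr_ge0 ?divr_ge0 ?sqr_ge0 ?ler0n //.
Qed.

Lemma binomial_variance n :
  binomial_expect n (fun k => (k%:R - n%:R * p) ^+ 2) = n%:R * (p * (1 - p)).
Proof.
(* Conditioning on a success moves the centre by 1, so the induction needs an arbitrary centre
   [c]. *)
suff H c : binomial_expect n (fun k => (k%:R - c) ^+ 2) =
    n%:R * (p * (1 - p)) + (n%:R * p - c) ^+ 2.
  by rewrite H subrr expr0n addr0.
elim: n c => [|n IH] c /=; first by ring.
rewrite IH (@eq_binomial_expect _ (fun k => (k.+1%:R - c) ^+ 2)
  (fun k => (k%:R - (c - 1)) ^+ 2)) ?IH => [|k]; rewrite -natr1; ring.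
Qed.

End Binomial.

(** * Lower bound for the sum of cubes of the binomial masses *)

Lemma square_approximation n : (0 < n)%N ->
  exists w, [/\ (0 < w)%N, (n <= w * w)%N & (w * w <= 4 * n)%N].
Proof.
elim: n => // -[_ _|n /(_ isT)[w [w0 nw wn]] _]; first by exists 1%N.
have [?|?] := leqP n.+2 (w * w); first by exists w; split => //; lia.
by exists w.+1; split => //; nia.
Qed.

Lemma card_nat_window N k0 w :
  (\sum_(k < N | (k0 <= k + w) && (k <= k0 + w)) 1 <= w.*2.+1)%N.
Proof.
rewrite -(big_mkord (fun k => (k0 <= k + w) && (k <= k0 + w))%N (fun=> 1%N)).
rewrite sum1_count -size_filter -(size_iota (k0 - w) w.*2.+1).
apply: uniq_leq_size; first by rewrite filter_uniq ?iota_uniq.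
by move=> k; rewrite mem_filter !mem_iota; lia.
Qed.

Section LowerBound.
Variables (R : archiRealFieldType) (p : R).
Hypotheses (p_gt0 : 0 < p) (p_lt1 : p < 1).
Local Notation b := (binomial_mass p).

Lemma binomial_chebyshev n w :
  \sum_(k < n.+1 | `|k%:R - n%:R * p| >= w%:R) b n k * w%:R ^+ 2 <= n%:R / 4.
Proof.
have b0 := binomial_mass_ge0 p_gt0 p_lt1.
apply: (@le_trans _ _ (n%:R * (p * (1 - p)))); last first.
  rewrite ler_wpM2l //.
  have : 0 <= (p - 1 / 2) ^+ 2 by exact: sqr_ge0.
  lra.
rewrite -binomial_variance (binomial_expect_sum _ _ (ltnSn n)) big_mkcond /=.
apply: ler_sum => k _; case: ifPn => [wk|_]; last by rewrite mulr_ge0 ?sqr_ge0.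
by rewrite ler_wpM2l // -[leRHS]real_normK ?num_real // lerXn2r ?nnegrE.
Qed.

(** By Chebyshev's inequality a window of half-width [w], of order [sqrt n], around the mean carries
    mass at least 3/4. It has at most [3 w] points, so by convexity of the cube the sum is at least
    of order [1 / w ^+ 2]. *)
Lemma sum_cube_mass_ge n : (0 < n)%N ->
  100%:R^-1 / n%:R <= \sum_(k < n.+1) b n k ^+ 3.
Proof.
move=> n0; have b0 := binomial_mass_ge0 p_gt0 p_lt1.
have [w [w0 nw wn]] := square_approximation n0.
pose k0 := Num.truncn (n%:R * p).
have np0 : 0 <= n%:R * p by rewrite mulr_ge0 // ltW.
have /andP[k0l k0r] := truncn_itv np0.
have wR : (0 : R) < w%:R by rewrite ltr0n.
have nR : (0 : R) < n%:R by rewrite ltr0n.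
pose W k := ((k0 <= k + w) && (k <= k0 + w))%N.
have out : \sum_(k < n.+1 | ~~ W k) b n k <= 1 / 4.
  rewrite -(@ler_pM2r _ (w%:R ^+ 2)) ?exprn_gt0 // mulr_suml.
  apply: (@le_trans _ _ (n%:R / 4)); last first.
    have : n%:R <= w%:R ^+ 2 :> R by rewrite -natrX ler_nat -mulnn.
    lra.
  apply: le_trans (binomial_chebyshev n w).
  rewrite big_mkcond [leRHS]big_mkcond /=; apply: ler_sum => k _.
  case: ifPn => // Wk; last by case: ifP => // _; rewrite mulr_ge0 ?sqr_ge0.
  suff -> : w%:R <= `|k%:R - n%:R * p| by [].
  move: Wk; rewrite /W negb_and -!ltnNge => /orP[kw|kw].
    rewrite ler_normr; apply/orP; right.
    have : (k + w).+1%:R <= k0%:R :> R by rewrite ler_nat.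
    rewrite -natr1 natrD; move: k0l; rewrite -/k0; lra.
  rewrite ler_normr; apply/orP; left.
  have : (k0 + w).+1%:R <= k%:R :> R by rewrite ler_nat.
  rewrite -natr1 natrD; move: k0r; rewrite -/k0 -natr1; lra.
have inW : 3 / 4 <= \sum_(k < n.+1 | W k) b n k.
  have := sum_binomial_mass p (ltnSn n); rewrite (bigID (fun k : 'I_n.+1 => W k)) /=.
  move: out; lra.
(* The average mass per point when mass 3/4 is spread over [3 w] points; below, the cube is bounded
   from below by its tangent line at [c]. *)
pose c : R := (4 * w%:R)^-1.
have c0 : 0 < c by rewrite invr_gt0 mulr_gt0.
have cw : c * w%:R = 1 / 4 by rewrite /c; field; rewrite gt_eqF.
apply: (@le_trans _ _ (\sum_(k < n.+1 | W k) (3 * c ^+ 2 * b n k - 2 * c ^+ 3))); last first.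
  rewrite big_mkcond /=; apply: ler_sum => k _; case: ifPn => _; last by rewrite exprn_ge0.
  rewrite -subr_ge0.
  have -> : b n k ^+ 3 - (3 * c ^+ 2 * b n k - 2 * c ^+ 3) =
    (b n k - c) ^+ 2 * (b n k + 2 * c) by ring.
  by rewrite mulr_ge0 ?sqr_ge0 // addr_ge0 // mulr_ge0 // ltW.
rewrite sumrB -mulr_sumr.
have cnt : \sum_(k < n.+1 | W k) 2 * c ^+ 3 <= 2 * c ^+ 3 * (3 * w%:R).
  rewrite -[X in _ <= X]mulr1.
  rewrite (eq_bigr (fun=> 2 * c ^+ 3 * 1%:R)) => [|k _]; last by rewrite mulr1.
  rewrite -mulr_sumr -natr_sum mulr1 ler_pM2l ?mulr_gt0 ?exprn_gt0 //.
  rewrite -natrM ler_nat; apply: leq_trans (card_nat_window _ _ _) _; lia.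
apply: (@le_trans _ _ (3 * c ^+ 2 * (3 / 4) - 2 * c ^+ 3 * (3 * w%:R))); last first.
  apply: lerB => //; rewrite ler_wpM2l // mulr_ge0 ?exprn_ge0 // ltW //.
have -> : 3 * c ^+ 2 * (3 / 4) - 2 * c ^+ 3 * (3 * w%:R) =
   c ^+ 2 * (9 / 4 - 6 * (c * w%:R)) by field.
rewrite cw.
have -> : c ^+ 2 = (16 * (w * w)%:R)^-1.
  by rewrite /c natrM; field; rewrite gt_eqF.
have : (4 * n)%:R^-1 <= (w * w)%:R^-1 :> R.
  by rewrite lef_pV2 ?ler_nat // posrE ltr0n ?muln_gt0 ?w0.
rewrite natrM !invfM.
have : 0 < n%:R^-1 :> R by rewrite invr_gt0.
move: (n%:R^-1) ((w * w)%:R^-1) => x y; lra.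
Qed.
End LowerBound.

(** * Histories of independent outcomes *)

Section Expectation.
Variables (R : realFieldType) (X : finType) (mu : X -> R).

(* Expectation over a history of [n] i.i.d. steps with law [mu], listed from
   the latest to the earliest. *)
Fixpoint expect n (f : seq X -> R) : R :=
  if n is n'.+1 then \sum_x mu x * expect n' (fun h => f (x :: h)) else f [::].

Lemma eq_expect n f g : (forall h, size h = n -> f h = g h) ->
  expect n f = expect n g.
Proof.
elim: n f g => [|n IH] f g fg /=; first exact: fg.
by apply: eq_bigr => x _; congr (_ * _); apply: IH => h hn; apply: fg; rewrite /= hn.
Qed.

Lemma expectD n f g : expect n (fun h => f h + g h) = expect n f + expect n g.
Proof.
elim: n f g => //= n IH f g.
by rewrite -big_split; apply: eq_bigr => x _ /=; rewrite IH mulrDr.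
Qed.

Lemma expectZ n c f : expect n (fun h => c * f h) = c * expect n f.
Proof.
elim: n f => //= n IH f.
by rewrite mulr_sumr; apply: eq_bigr => x _ /=; rewrite IH mulrCA.
Qed.

Lemma expect_sum n (I : Type) (r : seq I) (F : I -> seq X -> R) :
  expect n (fun h => \sum_(i <- r) F i h) = \sum_(i <- r) expect n (F i).
Proof.
elim: r => [|i r IH].
  rewrite big_nil (@eq_expect _ _ (fun=> 0 * 0)) ?expectZ ?mul0r // => h _.
  by rewrite big_nil.
by rewrite big_cons -IH -expectD; apply: eq_expect => h _; rewrite big_cons.
Qed.

Lemma expect_cat j k f :
  expect (j + k) f = expect j (fun g => expect k (fun h => f (g ++ h))).
Proof.
elim: j f => //= j IH f.
by apply: eq_bigr => x _; rewrite IH.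
Qed.

Hypotheses (mu_ge0 : forall x, 0 <= mu x) (mu1 : \sum_x mu x = 1).

Lemma expect_le n f g : (forall h, size h = n -> f h <= g h) ->
  expect n f <= expect n g.
Proof.
elim: n f g => [|n IH] f g fg /=; first exact: fg.
apply: ler_sum => x _; rewrite ler_wpM2l //.
by apply: IH => h hn; apply: fg; rewrite /= hn.
Qed.

Lemma expect_cst n c : expect n (fun=> c) = c.
Proof. by elim: n => //= n ->; rewrite -mulr_suml mu1 mul1r. Qed.

Lemma expect_ge0 n f : (forall h, 0 <= f h) -> 0 <= expect n f.
Proof.
by move=> f0; rewrite -[leLHS](expect_cst n); apply: expect_le => h _; exact: f0.
Qed.

(** Independence of the latest [j] steps from the [k] earlier ones. *)
Lemma expect_take_drop j k (f g : seq X -> R) :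
  expect (j + k) (fun h => f (take j h) * g (drop j h)) = expect j f * expect k g.
Proof.
rewrite expect_cat mulrC -expectZ; apply: eq_expect => h hj.
rewrite mulrC -expectZ; apply: eq_expect => h' _.
by rewrite take_cat drop_cat hj ltnn subnn take0 drop0 cats0.
Qed.

End Expectation.

(** * Arrival counts and the probability of balance *)

Section Arrivals.
Variables (R : archiRealFieldType) (d : nat) (p mbar : R).
Hypotheses (p_gt0 : 0 < p) (p_lt1 : p < 1) (mbar_ge0 : 0 <= mbar) (mbar_le1 : mbar <= 1).

Definition outcome : finType := (bool * {ffun 'I_d -> bool})%type.

Definition bernoulli_mass (c : R) (x : bool) : R := if x then c else 1 - c.

Definition outcome_mass (x : outcome) : R :=
  bernoulli_mass mbar x.1 * \prod_i bernoulli_mass p (x.2 i).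

Local Notation mu := outcome_mass.
Local Notation E := (expect mu).

Lemma outcome_mass_ge0 x : 0 <= mu x.
Proof.
rewrite /mu /bernoulli_mass mulr_ge0 ?prodr_ge0 // => [|i _].
  by case: ifP; rewrite ?subr_ge0.
by case: ifP; rewrite ?subr_ge0 ltW.
Qed.

(** Within one time slot the service outcome and the arrivals are independent, so the expectation of
    a product factors. *)
Lemma sum_outcome_mass (g : bool -> R) (f : 'I_d -> bool -> R) :
  \sum_x mu x * (g x.1 * \prod_i f i (x.2 i)) =
  (mbar * g true + (1 - mbar) * g false) *
  \prod_i (p * f i true + (1 - p) * f i false).
Proof.
rewrite (eq_bigr (fun i => \sum_x bernoulli_mass p x * f i x)) => [|i _]; last first.
  by rewrite big_bool.
rewrite bigA_distr_bigA /=.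
have -> : mbar * g true + (1 - mbar) * g false = \sum_x bernoulli_mass mbar x * g x.
  by rewrite big_bool.
rewrite big_distrlr pair_bigA /=; apply: eq_bigr => -[x y] _ /=.
by rewrite big_split /mu /=; ring.
Qed.

Lemma sum_outcome_mass1 : \sum_x mu x = 1.
Proof.
have := sum_outcome_mass (fun=> 1) (fun _ _ => 1).
rewrite (eq_bigr mu) => [->|x _]; last by rewrite big1 ?mulr1.
by rewrite big1 => [|i _]; ring.
Qed.

Definition arrivals (h : seq outcome) (i : 'I_d) : nat := \sum_(x <- h) x.2 i.

Lemma arrivals_cons x h i : arrivals (x :: h) i = (x.2 i + arrivals h i)%N.
Proof. by rewrite /arrivals big_cons. Qed.

Lemma arrivals_le h i : (arrivals h i <= size h)%N.
Proof.
elim: h => [|x h IH]; first by rewrite /arrivals big_nil.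
by rewrite arrivals_cons /= -add1n leq_add // leq_b1.
Qed.

(** The arrival counts of the queues are independent binomial variables; the induction conditions on
    the latest step. *)
Lemma expect_prod_arrivals n (f : 'I_d -> nat -> R) :
  E n (fun h => \prod_i f i (arrivals h i)) = \prod_i binomial_expect p n (f i).
Proof.
elim: n f => [|n IH] f /=.
  by apply: eq_bigr => i _; rewrite /arrivals big_nil.
pose F i (x : bool) := binomial_expect p n (fun k => f i (x + k)%N).
rewrite (eq_bigr (fun x => mu x * (1 * \prod_i F i (x.2 i)))) => [|x _].
  rewrite (sum_outcome_mass (fun=> 1)) !mulr1 addrC subrK mul1r.
  by apply: eq_bigr => i _; rewrite addrC.
rewrite mul1r -IH; congr (_ * _); apply: eq_expect => h _.
by apply: eq_bigr => i _; rewrite arrivals_cons.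
Qed.

(** The offset [z] stands for arrivals in later steps that have been stripped off the history;
    [z = 0] is balance proper. *)
Definition balanced (z : 'I_d -> nat) (h : seq outcome) : bool :=
  [forall i, forall j, (arrivals h i + z i == arrivals h j + z j)%N].

Definition balanced_prob n : R := \sum_(k < n.+1) binomial_mass p n k ^+ d.

Local Notation u := balanced_prob.

Lemma balanced_prob_ge0 n : 0 <= u n.
Proof. by apply: sumr_ge0 => k _; rewrite exprn_ge0 ?binomial_mass_ge0. Qed.

Hypothesis d_gt0 : (0 < d)%N.

(** Splitting by the common value [k] turns balance into a sum of products over the queues, to which
    independence applies. *)
Lemma balanced_sum z h N : (forall i, (arrivals h i + z i < N)%N) ->
  (balanced z h)%:R = \sum_(k < N) \prod_i ((arrivals h i + z i)%N == k)%:R :> R.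
Proof.
move=> hN; have prodE (k : nat) :
    \prod_i ((arrivals h i + z i)%N == k)%:R = [forall i, (arrivals h i + z i)%N == k]%:R :> R.
  case: forallP => [all_k|/forallP]; first by rewrite big1 // => i _; rewrite all_k.
  by rewrite negb_forall => /existsP[i /negbTE ik]; rewrite (bigD1 i) //= ik mul0r.
pose i0 := Ordinal d_gt0.
rewrite (bigD1 (Ordinal (hN i0))) //= prodE big1 ?addr0 => [|k kN].
  congr (nat_of_bool _)%:R; apply/forallP/forallP => H i.
    by move/forallP: (H i) => /(_ i0).
  by apply/forallP => j; rewrite (eqP (H i)) (eqP (H j)).
rewrite prodE; case: forallP => // /(_ i0) /eqP H.
by move/eqP: kN; case; apply/val_inj; rewrite /= H.
Qed.

Lemma shifted_binomial_expect n z k :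
  binomial_expect p n (fun j => ((j + z)%N == k)%:R) =
  if (z <= k)%N then binomial_mass p n (k - z)%N else 0.
Proof.
case: leqP => zk.
  by apply: eq_binomial_expect => j; congr (nat_of_bool _)%:R; apply/eqP/eqP; lia.
rewrite -[RHS](binomial_expect_cst p n); apply: eq_binomial_expect => j.
by case: eqP => //; lia.
Qed.

Lemma expect_balanced0 n : E n (fun h => (balanced (fun=> 0%N) h)%:R) = u n.
Proof.
rewrite (@eq_expect _ _ _ _ _ (fun h => \sum_(k < n.+1) \prod_i (arrivals h i == k)%:R)).
  rewrite expect_sum; apply: eq_bigr => k _.
  rewrite (expect_prod_arrivals n (fun _ j => (j == k)%:R)).
  by rewrite prodr_const card_ord.
move=> h hn; rewrite (@balanced_sum _ _ n.+1) => [|i]; last first.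
  by rewrite addn0 ltnS -hn arrivals_le.
by apply: eq_bigr => k _; apply: eq_bigr => i _; rewrite addn0.
Qed.

(* AM-GM: a product of [d] translates of the binomial mass function is at most
   the average of their [d]-th powers, each of which sums to [u n]. *)
Lemma expect_balanced_le n z : E n (fun h => (balanced z h)%:R) <= u n.
Proof.
have b0 := binomial_mass_ge0 p_gt0 p_lt1.
(* Large enough to contain the support of every translate. *)
pose N := (n + \sum_i z i).+1.
have zN i : (n + z i < N)%N by rewrite ltnS leq_add2l (bigD1 i) //= leq_addr.
pose c i k : R := if (z i <= k)%N then binomial_mass p n (k - z i)%N else 0.
have c0 i k : 0 <= c i k by rewrite /c; case: ifP.
have -> : E n (fun h => (balanced z h)%:R) = \sum_(k < N) \prod_i c i k.
  rewrite (@eq_expect _ _ _ _ _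
    (fun h => \sum_(k < N) \prod_i ((arrivals h i + z i)%N == k)%:R)).
    rewrite expect_sum; apply: eq_bigr => k _.
    rewrite (expect_prod_arrivals n (fun i j => ((j + z i)%N == k)%:R)).
    by apply: eq_bigr => i _; exact: shifted_binomial_expect.
  move=> h hn; apply: balanced_sum => i; apply: leq_ltn_trans (zN i).
  by rewrite leq_add2r -hn arrivals_le.
have dR : 0 < d%:R :> R by rewrite ltr0n.
have cu i : \sum_(k < N) c i k ^+ d = u n.
  rewrite -(big_mkord xpredT (fun k => c i k ^+ d)) /=.
  rewrite (big_cat_nat (leq0n (z i))) /=; last first.
    by rewrite ltnW // (leq_ltn_trans _ (zN i)) // leq_addl.
  rewrite big1_seq ?add0r => [|k /=]; last first.
    by rewrite mem_index_iota /c => /andP[_ kz]; rewrite leqNgt kz /= expr0n gtn_eqF.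
  rewrite -{1}[z i]add0n big_addn big_mkord /u.
  rewrite -(@widen_sum_mass _ p n (N - z i) (fun _ x => x ^+ d)) => [|k|].
  - by apply: eq_bigr => k _; rewrite /c leq_addl addnK.
  - by rewrite expr0n gtn_eqF.
  - by have := zN i; lia.
apply: (@le_trans _ _ (\sum_(k < N) (\sum_i c i k ^+ d) / d%:R)); last first.
  rewrite -mulr_suml exchange_big /= (eq_bigr (fun=> u n)) // sumr_const card_ord.
  by rewrite -[X in X / _]mulr_natr mulfK ?gt_eqF.
apply: ler_sum => k _.
have [] := @leif_AGM R 'I_d predT (fun i => c i k ^+ d) (fun i _ => exprn_ge0 _ (c0 i k)).
rewrite cardT size_enum_ord prodrXl.
rewrite ler_pXn2r ?mulr_suml // ?nnegrE ?prodr_ge0 ?sumr_ge0 // => i _.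
by rewrite divr_ge0 ?exprn_ge0 // ler0n.
Qed.

(** Of the [d] factors, [j] are bounded by the maximum, one is kept to sum to 1, and the others are
    at most 1. *)
Lemma balanced_prob_le_max n j : (j < d)%N -> u n <= max_mass p n ^+ j.
Proof.
move=> jd; have b0 := binomial_mass_ge0 p_gt0 p_lt1.
rewrite -[leRHS]mulr1 -(sum_binomial_mass p (ltnSn n)) mulr_sumr.
apply: ler_sum => k _; rewrite -(subnKC jd) addSnnS exprD.
apply: ler_pM; rewrite ?exprn_ge0 //.
  by rewrite lerXn2r ?nnegrE ?max_mass_ge0 ?binomial_mass_le_max.
by rewrite exprS -[leRHS]mulr1 ler_wpM2l // exprn_ile1 ?binomial_mass_le1.
Qed.

Lemma balanced_prob_ge n : (d <= 3)%N -> (0 < n)%N -> 100%:R^-1 / n%:R <= u n.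
Proof.
move=> d3 n0; apply: le_trans (sum_cube_mass_ge p_gt0 p_lt1 n0) _.
by apply: ler_sum => k _; rewrite ler_wiXn2l ?binomial_mass_ge0 ?binomial_mass_le1.
Qed.

End Arrivals.

(** * Renewal sequences *)

Section Renewal.
Variables (R : realType) (v r : nat -> R).
Hypotheses (v_ge0 : forall n, 0 <= v n) (r_ge0 : forall n, 0 <= r n).
Hypothesis r_le : forall m n, (m <= n)%N -> r n <= r m.
Hypothesis r0 : r 0%N = 1.
Hypothesis renewal : forall n, \sum_(j < n.+1) r j * v (n - j)%N = 1.

Lemma summable_tail C e : (forall N, \sum_(n < N) v n <= C) -> 0 < e ->
  exists K, forall N, \sum_(K <= n < N) v n <= e.
Proof.
move=> vC e0; pose A : set R := [set x | exists N, x = \sum_(n < N) v n]%classic.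
have supA : has_sup A.
  by split; [exists (\sum_(n < 0) v n), 0%N|exists C => _ [N ->]].
have [_ [K ->] supK] := sup_adherent e0 supA.
exists K => N; have [NK|/ltnW KN] := leqP N K; first by rewrite big_geq ?ltW.
have : \sum_(n < N) v n <= sup A by apply: ub_le_sup; [exact: supA.2|exists N].
rewrite -(big_mkord xpredT) (big_cat_nat (leq0n _) KN) /= big_mkord; lra.
Qed.

Lemma renewal_rev n : \sum_(k < n.+1) v k * r (n - k)%N = 1.
Proof.
rewrite -[RHS](renewal n) (reindex_inj rev_ord_inj) /=.
by apply: eq_bigr => k _; rewrite mulrC subSS subKn // -ltnS.
Qed.

(** As [r] is nonincreasing, the renewal equation at time [N] gives
    [r N * \sum_(k < N) v k <= 1]. *)
Lemma renewal_dvg e : (forall M, exists N, M <= \sum_(n < N) v n) -> 0 < e ->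
  exists n, r n <= e.
Proof.
move=> vM e0; have [N vN] := vM e^-1; exists N.
have : r N * \sum_(k < N) v k <= 1.
  rewrite -[leRHS](renewal_rev N) mulr_sumr big_ord_recr /= -[leLHS]addr0.
  apply: lerD; last by rewrite mulr_ge0.
  by apply: ler_sum => k _; rewrite mulrC ler_wpM2l // r_le // leq_subr.
rewrite -[in X in _ -> X](mul1r e) -ler_pdivrMr //.
by apply: le_trans; rewrite ler_wpM2l.
Qed.

(** Beyond some [K] the terms of [v] sum to at most 1/2, so the first [K] terms of the renewal
    equation at time [K + n] contribute at least 1/2, and they are at most [C * r n]. *)
Lemma renewal_cvg C : (forall N, \sum_(n < N) v n <= C) ->
  exists2 c, 0 < c & forall n, c <= r n.
Proof.
move=> vC; have half0 : (0 : R) < 2^-1 by [].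
have [K vK] := summable_tail vC half0.
have r_le1 n : r n <= 1 by rewrite -r0 r_le.
have v0 : v 0%N = 1 by have := renewal 0; rewrite big_ord1 r0 mul1r.
have C0 : 0 < C by apply: lt_le_trans (vC 1%N); rewrite big_ord1 v0.
exists (C * 2)^-1 => [|n]; first by rewrite invr_gt0 mulr_gt0.
have := renewal_rev (K + n).
rewrite -(big_mkord xpredT (fun k => v k * r (K + n - k)%N)) /=.
rewrite (big_cat_nat (leq0n K)) /=; last by lia.
have : \sum_(K <= k < (K + n).+1) v k * r (K + n - k)%N <= 2^-1.
  apply: le_trans (vK (K + n).+1); apply: ler_sum => k _.
  by rewrite ler_piMr.
have : \sum_(0 <= k < K) v k * r (K + n - k)%N <= C * r n.
  rewrite big_mkord; apply: le_trans (ler_wpM2r (r_ge0 n) (vC K)).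
  rewrite mulr_suml; apply: ler_sum => k _; rewrite ler_wpM2l // r_le //.
  by have := ltn_ord k; lia.
move=> A B S; rewrite invfM ler_pdivrMl //; lra.
Qed.

(** If the partial sums of [r] stayed below [M], then the terms with [v <= (2 * M)^-1] would
    contribute at most 1/2 to the renewal equation. The [K] other terms would force
    [1 <= 2 * K * r n] for every [n], contradicting summability. *)
Lemma renewal_null (vM : forall e, 0 < e -> exists K, forall n, (K <= n)%N -> v n <= e) :
  forall M, exists N, M <= \sum_(j < N) r j.
Proof.
move=> M; apply: contrapT => /forallNP H.
have rM N : \sum_(j < N) r j < M by rewrite ltNge; apply/negP/H.
have M0 : 0 < M by have := rM 0%N; rewrite big_ord0.
have [|K vK] := vM (2 * M)^-1; first by rewrite invr_gt0 mulr_gt0.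
have r_le1 n : r n <= 1 by rewrite -r0 r_le.
have v_le1 n : v n <= 1.
  rewrite -[leRHS](renewal n) big_ord_recl /= r0 mul1r subn0 lerDl.
  by apply: sumr_ge0 => j _; rewrite mulr_ge0.
have r_ge n : 1 <= 2 * K%:R * r n.
  have := renewal_rev (K + n).
  rewrite -(big_mkord xpredT (fun k => v k * r (K + n - k)%N)) /=.
  rewrite (big_cat_nat (leq0n K)) /=; last by lia.
  have : \sum_(K <= k < (K + n).+1) v k * r (K + n - k)%N <= 2^-1.
    apply: (@le_trans _ _ ((2 * M)^-1 * M)); last first.
      by rewrite invfM mulfVK ?gt_eqF.
    apply: (@le_trans _ _ ((2 * M)^-1 * \sum_(j < n.+1) r j)); last first.
      by rewrite ler_wpM2l ?(ltW (rM _)) // invr_ge0 mulr_ge0 // ltW.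
    rewrite -{1}[K]add0n big_addn -addnS addKn big_mkord mulr_sumr.
    rewrite [leRHS](reindex_inj rev_ord_inj) /=; apply: ler_sum => k _.
    have -> : (K + n - (k + K) = n.+1 - k.+1)%N by lia.
    by rewrite ler_wpM2r // vK // leq_addl.
  have : \sum_(0 <= k < K) v k * r (K + n - k)%N <= K%:R * r n.
    rewrite big_mkord -[K in leRHS]card_ord -sum1_card natr_sum mulr_suml.
    apply: ler_sum => k _; apply: ler_pM => //.
    by apply: r_le; have := ltn_ord k; lia.
  lra.
have K0 : 0 < 2 * K%:R :> R.
  have := r_ge 0%N; rewrite r0 mulr1; exact: lt_le_trans.
pose N := (Num.truncn (2 * K%:R * M)).+1.
have /andP[_ NM] := truncn_itv (mulr_ge0 (ltW K0) (ltW M0)).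
have : N%:R <= 2 * K%:R * \sum_(j < N) r j.
  rewrite -[X in X%:R <= _]card_ord -sum1_card natr_sum mulr_sumr.
  by apply: ler_sum => j _; exact: r_ge.
have : 2 * K%:R * \sum_(j < N) r j < 2 * K%:R * M by rewrite ltr_pM2l.
move: NM; rewrite -/N; lra.
Qed.

End Renewal.

(** * The queues *)

Lemma expr_unbounded (R : archiRealFieldType) (M x : R) : 1 < x ->
  exists n, M <= x ^+ n.
Proof.
move=> x1; have x10 : 0 < x - 1 by rewrite subr_gt0.
have lin n : n%:R * (x - 1) <= x ^+ n.
  elim: n => [|n IH]; first by rewrite mul0r.
  have -> : x ^+ n.+1 = (x - 1) * x ^+ n + x ^+ n by rewrite exprS; ring.
  rewrite -natr1 mulrDl mul1r addrC.
  by apply: lerD IH; rewrite ler_peMr ?exprn_ege1 ?ltW.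
have [M0|/ltW M0] := leP M 0; first by exists 0%N; rewrite expr0 (le_trans M0).
have /andP[_ /ltW H] := truncn_itv (divr_ge0 M0 (ltW x10)).
by exists (Num.truncn (M / (x - 1))).+1; rewrite (le_trans _ (lin _)) // -ler_pdivrMr.
Qed.

Section Queues.
Variable d : nat.

Definition queues (h : seq (outcome d)) : qstate d :=
  foldr (fun (x : outcome d) q => batch_step q x.1 x.2) (empty_queues d) h.

Definition is_empty h : bool := queues h == empty_queues d.

(** Histories list the latest step first, so suffixes are earlier times; every time except the
    initial one is tested for emptiness. *)
Fixpoint no_return (h : seq (outcome d)) : bool :=
  if h is _ :: h' then no_return h' && ~~ is_empty h else true.

(** The chain restarts afresh whenever it is at the empty state. *)
Lemma queues_cat g h : is_empty h -> queues (g ++ h) = queues g.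
Proof. by move=> /eqP h0; rewrite /queues foldr_cat -/(queues h) h0. Qed.

(** The only [j] that counts is the time elapsed since the last visit to the empty state. In the
    induction, if the queues are empty after [x] then only [j = 0] survives; otherwise the [j] of
    [h] is shifted by one. *)
Lemma last_exit h :
  (\sum_(j < (size h).+1) (no_return (take j h) && is_empty (drop j h)) = 1)%N.
Proof.
elim: h => [|x h IH]; first by rewrite big_ord1 /is_empty eqxx.
rewrite big_ord_recl /= (eq_bigr (fun j : 'I_(size h).+1 =>
  ~~ is_empty (x :: h) * (no_return (take j h) && is_empty (drop j h))))%N => [|j _].
  by rewrite -big_distrr IH; case: is_empty.
rewrite add0n; have [e|] := boolP (is_empty (drop j h)).
  have -> : is_empty (x :: take j h) = is_empty (x :: h).
    by rewrite /is_empty -(queues_cat (x :: take j h) e) /= cat_take_drop.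
  by rewrite !andbT andbC mulnb.
by rewrite !andbF muln0.
Qed.

Lemma queues_cons x h i : queues (x :: h) i =
  (queues h i - x.1 * service_allowed (queues h) + x.2 i)%N.
Proof. by rewrite /= ffunE. Qed.

(** Service removes one customer from every queue at once, so the number [D] of departures is common
    to all queues and differences of lengths are differences of arrivals. *)
Lemma departures h : exists D, forall i, (queues h i + D = arrivals h i)%N.
Proof.
elim: h => [|x h [D IH]].
  by exists 0%N => i; rewrite /arrivals big_nil ffunE.
exists (D + x.1 * service_allowed (queues h))%N => i.
rewrite arrivals_cons -IH queues_cons.
have : (x.1 * service_allowed (queues h) <= queues h i)%N.
  by case: (boolP (service_allowed _)) => [/forallP/(_ i)|_]; case: x.1; lia.
lia.
Qed.

Lemma is_empty_balanced h : is_empty h -> balanced (fun=> 0%N) h.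
Proof.
move=> /eqP h0; have [D hD] := departures h.
by apply/forallP => i; apply/forallP => j; rewrite -!hD h0 !ffunE.
Qed.

Lemma balanced_queues h i j : balanced (fun=> 0%N) h -> queues h i = queues h j.
Proof.
have [D hD] := departures h.
by move=> /forallP /(_ i) /forallP /(_ j) /eqP; rewrite -!hD; lia.
Qed.

Lemma balanced_cons (z : 'I_d -> nat) (x : outcome d) h :
  balanced z (x :: h) = balanced (fun i => x.2 i + z i)%N h.
Proof.
apply: eq_forallb => i; apply: eq_forallb => j; rewrite !arrivals_cons.
by rewrite !addnA ![(x.2 _ + _)%N]addnC.
Qed.

Hypothesis d_gt0 : (0 < d)%N.

Definition drain : outcome d := (true, [ffun=> false]).

Definition balanced_below L h : bool :=
  balanced (fun=> 0%N) h && [forall i, queues h i <= L]%N.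

Lemma balanced_below0 h : balanced_below 0 h -> is_empty h.
Proof.
move=> /andP[_ /forallP h0]; apply/eqP/ffunP => i; rewrite ffunE.
by apply/eqP; rewrite -leqn0.
Qed.

Lemma balanced_below_drain L h :
  balanced_below L.+1 h -> balanced_below L (drain :: h).
Proof.
move=> /andP[hb /forallP hL]; apply/andP; split.
  rewrite balanced_cons; apply: etrans hb.
  by apply: eq_forallb => i; apply: eq_forallb => j; rewrite !ffunE.
apply/forallP => i; rewrite queues_cons ffunE addn0 mul1n.
(* If service is blocked, some queue [j] is empty, and balance makes all of them empty. *)
have := hL i; case: (boolP (service_allowed _)) => [_|/forallPn[j]]; first by lia.
by rewrite (balanced_queues j i hb); lia.
Qed.

(** * Probabilities of emptiness and of no return *)

Variables (R : realType) (p mbar : R).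
Hypotheses (p_gt0 : 0 < p) (p_lt_mbar : p < mbar) (mbar_le1 : mbar <= 1).

Let p_lt1 : p < 1. Proof. exact: lt_le_trans mbar_le1. Qed.
Let mbar_ge0 : 0 <= mbar. Proof. by rewrite ltW // (lt_trans p_gt0). Qed.

Local Notation mu := (outcome_mass p mbar).
Local Notation E := (expect (@outcome_mass _ d p mbar)).
Local Notation u := (balanced_prob d p).
Local Notation mu_ge0 := (outcome_mass_ge0 p_gt0 p_lt1 mbar_ge0 mbar_le1).
Local Notation mu1 := (sum_outcome_mass1 d p mbar).

Definition empty_prob n : R := E n (fun h => (is_empty h)%:R).
Definition no_return_prob n : R := E n (fun h => (no_return h)%:R).
Local Notation v := empty_prob.
Local Notation r := no_return_prob.

Lemma empty_prob_ge0 n : 0 <= v n.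
Proof. by apply: (expect_ge0 mu_ge0 mu1) => h; exact: ler0n. Qed.

Lemma no_return_prob_ge0 n : 0 <= r n.
Proof. by apply: (expect_ge0 mu_ge0 mu1) => h; exact: ler0n. Qed.

Lemma no_return_prob_le m n : (m <= n)%N -> r n <= r m.
Proof.
elim: n => [|n IH]; first by rewrite leqn0 => /eqP ->.
rewrite leq_eqVlt => /orP[/eqP-> //|/IH]; apply: le_trans.
rewrite -[leRHS]mul1r -mu1 mulr_suml; apply: ler_sum => x _.
rewrite ler_wpM2l ?mu_ge0 //; apply: (expect_le mu_ge0) => h _.
by rewrite ler_nat /=; case: (no_return h); case: (is_empty _).
Qed.

(** Expectation of [last_exit]: the steps before and after the last visit to the empty state are
    independent. *)
Lemma queues_renewal n : \sum_(j < n.+1) r j * v (n - j)%N = 1.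
Proof.
rewrite -[RHS](expect_cst mu1 n).
rewrite (@eq_expect _ _ _ n (fun=> 1) (fun h => \sum_(j < n.+1)
   (no_return (take j h))%:R * (is_empty (drop j h))%:R)) => [|h hn].
  rewrite expect_sum; apply: eq_bigr => j _; rewrite -expect_take_drop subnKC //.
  by rewrite -ltnS.
rewrite -[LHS](congr1 (fun n => n%:R) (last_exit h)) natr_sum hn.
by apply: eq_bigr => j _; rewrite -mulnb natrM.
Qed.

Lemma empty_prob_le n : v n <= u n.
Proof.
rewrite -(expect_balanced0 p mbar d_gt0); apply: (expect_le mu_ge0) => h _.
by rewrite ler_nat; case: (boolP (is_empty h)) => // /is_empty_balanced ->.
Qed.

(** Each [drain] step lowers the level by one; of all outcomes of the next step only [drain] is
    kept. *)
Lemma empty_prob_ge n L :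
  mu drain ^+ L * E n (fun h => (balanced_below L h)%:R) <= v (n + L).
Proof.
elim: L n => [|L IH] n.
  rewrite mul1r addn0; apply: (expect_le mu_ge0) => h _; rewrite ler_nat.
  by case: (boolP (balanced_below 0 h)) => // /balanced_below0 ->.
rewrite addnS -addSn; apply: le_trans (IH n.+1).
rewrite exprSr -mulrA ler_wpM2l ?exprn_ge0 ?mu_ge0 //= (bigD1 drain) //=.
rewrite ler_wpDr ?sumr_ge0 // => [x _|].
  by rewrite mulr_ge0 ?mu_ge0 // (expect_ge0 mu_ge0 mu1) // => h; exact: ler0n.
rewrite ler_wpM2l ?mu_ge0 //; apply: (expect_le mu_ge0) => h _; rewrite ler_nat.
by case: (boolP (balanced_below L.+1 h)) => // /balanced_below_drain ->.
Qed.

(** [rho] is the mean of [theta] to the power (arrivals to a queue minus service successes) in one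
    step. The drift [p - mbar] is negative, so a [theta] slightly above 1 makes [rho] less than 1;
    this choice makes [1 - rho] factor explicitly. *)
Let theta : R := 1 + (mbar - p).
Let rho : R := (p * theta + (1 - p)) * (mbar / theta + (1 - mbar)).

Let theta_gt1 : 1 < theta. Proof. by rewrite /theta ltrDl subr_gt0. Qed.
Let theta_gt0 : 0 < theta. Proof. exact: lt_trans theta_gt1. Qed.

Let rho_ge0 : 0 <= rho.
Proof.
have th0 := ltW theta_gt0; have p0 := ltW p_gt0; have p1 := ltW p_lt1.
rewrite /rho.
by apply: mulr_ge0; apply: addr_ge0; rewrite ?mulr_ge0 ?invr_ge0 ?subr_ge0.
Qed.

Let rho_lt1 : rho < 1.
Proof.
rewrite -subr_gt0.
have -> : 1 - rho = (mbar - p) * (mbar - p) * (1 - p * (1 - mbar)) / theta.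
  by rewrite /rho /theta; field; rewrite gt_eqF.
have : p * (1 - mbar) < 1.
  have : 0 <= p * mbar by rewrite mulr_ge0 // ltW.
  have := p_lt1; lra.
by move=> ?; rewrite divr_gt0 // !mulr_gt0 ?subr_gt0.
Qed.

(* Sums [theta] to the power (arrivals to queue [i] minus service successes)
   over all starting times; it dominates [theta ^+ queues h i] for the queue [i]
   that was empty when service was last impossible. *)
Fixpoint overload i (h : seq (outcome d)) : R :=
  if h is x :: h' then theta ^+ x.2 i * (theta ^- x.1 * overload i h' + 1) else 1.

Lemma overload_ge0 i h : 0 <= overload i h.
Proof.
elim: h => //= x h IH.
by rewrite mulr_ge0 ?addr_ge0 ?mulr_ge0 ?invr_ge0 ?exprn_ge0 // ltW.
Qed.

(** While service is allowed, the witness [i] of the earlier history persists. When it is blocked,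
    an empty queue becomes the witness and the summand [1] in [overload] dominates its new
    length. *)
Lemma overload_queues h : exists i, theta ^+ queues h i <= overload i h.
Proof.
elim: h => [|x h [i IH]]; first by exists (Ordinal d_gt0); rewrite ffunE.
have [served|/forallPn[j j0]] := boolP (service_allowed (queues h)); last first.
  exists j; rewrite queues_cons.
  have -> : (queues h j - x.1 * service_allowed (queues h))%N = 0%N by lia.
  rewrite /= add0n ler_peMr ?exprn_ge0 ?(ltW theta_gt0) // lerDr.
  by rewrite mulr_ge0 ?overload_ge0 // invr_ge0 exprn_ge0 // ltW.
exists i; rewrite queues_cons served muln1 addnC exprD /=.
rewrite ler_wpM2l ?exprn_ge0 ?(ltW theta_gt0) //.
apply: (@le_trans _ _ (theta ^- x.1 * theta ^+ queues h i)); last first.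
  by rewrite ler_wpDr // ler_wpM2l // invr_ge0 exprn_ge0 // ltW.
have /forallP/(_ i) := served => qi.
have xq : (x.1 <= queues h i)%N by case: x.1.
by rewrite -{2}(subnKC xq) exprD mulKf // expf_neq0 // gt_eqF.
Qed.

Fixpoint overload_bound n : R :=
  if n is n'.+1 then rho * overload_bound n' + theta * u n' else 1.

Local Notation y := overload_bound.

(** Conditioning on the latest step changes the offset, hence the uniformity in [z]. Old starting
    times are multiplied by [rho] on average; the new one costs at most [theta] times a balance
    probability, itself at most [u n]. *)
Lemma expect_overload_le i n z :
  E n (fun h => (balanced z h)%:R * overload i h) <= y n.
Proof.
elim: n z => [|n IH] z /=; first by rewrite mulr1 lern1 leq_b1.
have th0 k : 0 <= theta ^+ k by rewrite exprn_ge0 // ltW.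
have u0 : 0 <= u n by exact: balanced_prob_ge0.
pose F (x : outcome d) := theta ^- x.1 * theta ^+ x.2 i * y n + theta ^+ x.2 i * u n.
apply: (@le_trans _ _ (\sum_x mu x * F x)).
  apply: ler_sum => x _; rewrite ler_wpM2l ?mu_ge0 //.
  pose z' j := (x.2 j + z j)%N.
  rewrite (@eq_expect _ _ _ _ _ (fun h => theta ^- x.1 * theta ^+ x.2 i *
     ((balanced z' h)%:R * overload i h) + theta ^+ x.2 i * (balanced z' h)%:R)).
    rewrite expectD !expectZ; apply: lerD; rewrite ler_wpM2l ?mulr_ge0 ?invr_ge0 //.
    exact: (expect_balanced_le p_gt0 p_lt1).
  by move=> h _; rewrite balanced_cons; ring.
rewrite /F; under eq_bigr do rewrite mulrDr.
(* Writes the weight of queue [i] as a product over all queues, so that [sum_outcome_mass]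
   applies. *)
pose f j (b : bool) : R := if j == i then theta ^+ b else 1.
have fE (x : outcome d) : \prod_j f j (x.2 j) = theta ^+ x.2 i.
  rewrite (bigD1 i) //= big1 => [|j /negbTE ji]; first by rewrite /f eqxx mulr1.
  by rewrite /f ji.
have fsum : \prod_j (p * f j true + (1 - p) * f j false) = p * theta + (1 - p).
  rewrite (bigD1 i) //= big1 => [|j /negbTE ji]; last by rewrite /f ji; ring.
  by rewrite /f eqxx expr1 expr0; ring.
rewrite big_split /=.
rewrite (eq_bigr (fun x => mu x * (theta ^- x.1 * \prod_j f j (x.2 j)) * y n)); last first.
  by move=> x _; rewrite fE mulrA.
rewrite [X in _ + X <= _](eq_bigr
  (fun x => mu x * (1 * \prod_j f j (x.2 j)) * u n)); last first.
  by move=> x _; rewrite fE mul1r mulrA.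
rewrite -!mulr_suml.
rewrite (sum_outcome_mass p mbar (fun b => theta ^- b)) (sum_outcome_mass p mbar (fun=> 1)).
rewrite fsum expr1 expr0 invr1; apply: lerD.
  by rewrite mulr1 [X in X * y n]mulrC.
rewrite ler_wpM2r // !mulr1 [mbar + _]addrC subrK mul1r -subr_ge0.
have -> : theta - (p * theta + (1 - p)) = (1 - p) * (theta - 1) by ring.
by rewrite mulr_ge0 ?subr_ge0 // ltW.
Qed.

(** Markov's inequality: if balanced queues exceed [L], so does the witness of [overload_queues].
    That queue depends on the history, so a sum over all queues is taken, whence the factor [d]. *)
Lemma balanced_prob_le n L :
  u n <= E n (fun h => (balanced_below L h)%:R) + theta ^- L * (d%:R * y n).
Proof.
have th0 k : 0 <= theta ^- k by rewrite invr_ge0 exprn_ge0 // ltW.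
rewrite -(expect_balanced0 p mbar d_gt0).
apply: (@le_trans _ _ (E n (fun h => (balanced_below L h)%:R +
  theta ^- L * \sum_i (balanced (fun=> 0%N) h)%:R * overload i h))); last first.
  rewrite expectD expectZ expect_sum lerD2l ler_wpM2l //.
  rewrite -[X in X%:R * _]card_ord -sum1_card natr_sum mulr_suml.
  by apply: ler_sum => i _; rewrite mul1r expect_overload_le.
apply: (expect_le mu_ge0) => h _; rewrite /balanced_below.
have sum0 : 0 <= \sum_i overload i h by apply: sumr_ge0 => i _; exact: overload_ge0.
rewrite -mulr_sumr; case: (boolP (balanced _ h)) => hb /=; last first.
  by rewrite mul0r mulr0 addr0.
case: forallP => [_|/forallP]; first by rewrite mul1r lerDl mulr_ge0.
rewrite negb_forall => /existsP[j jL]; rewrite mul1r add0r mulrC.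
rewrite ler_pdivlMr ?exprn_gt0 // mul1r.
have [i hi] := overload_queues h; apply: (@le_trans _ _ (overload i h)).
  apply: le_trans hi; rewrite ler_eXn2l // (balanced_queues i j hb) ltnW //.
  by rewrite ltnNge.
by rewrite (bigD1 i) //= lerDl sumr_ge0 // => k _; exact: overload_ge0.
Qed.

(** Summing the recursion bounds [(1 - rho) \sum y] by [1 + theta \sum u], and the initial 1 is
    absorbed because [u 0 = 1]. *)
Lemma sum_overload_bound N : (0 < N)%N ->
  \sum_(n < N) y n <= (1 + theta) / (1 - rho) * \sum_(n < N) u n.
Proof.
case: N => // N _.
have u_ge0 n : 0 <= u n by exact: balanced_prob_ge0.
have y_ge0 n : 0 <= y n.
  by elim: n => //= n IH; rewrite addr_ge0 // mulr_ge0 // (ltW theta_gt0).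
have U1 : 1 <= \sum_(n < N.+1) u n.
  rewrite big_ord_recl {1}/balanced_prob big_ord1 /binomial_mass /= expr1n lerDl.
  by apply: sumr_ge0 => n _; exact: u_ge0.
rewrite mulrAC ler_pdivlMr ?subr_gt0 // mulrBr mulr1 lerBlDr.
rewrite [leLHS](_ : _ = 1 + \sum_(n < N) (rho * y n + theta * u n)); last first.
  by rewrite big_ord_recl.
rewrite big_split -!mulr_sumr /= [X in _ <= X + _]mulrDl mul1r.
rewrite -addrA lerD // addrC [_ * rho]mulrC; apply: lerD.
  by rewrite ler_wpM2l ?(ltW theta_gt0) // big_ord_recr lerDl /= u_ge0.
by rewrite ler_wpM2l // big_ord_recr lerDl /= y_ge0.
Qed.

(** * Divergence, decay and summability of the emptiness probabilities *)

Lemma balanced_prob_dvg : (d <= 3)%N -> forall M, exists N, M <= \sum_(n < N) u n.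
Proof.
move=> d3 M; apply: contrapT => /forallNP uM.
apply: (@dvg_harmonic R); apply: nondecreasing_is_cvgn.
  by apply: nondecreasing_series => n _ _; exact: harmonic_ge0.
exists (100%:R * M) => _ [N _ <-].
rewrite /series /= big_mkord.
have : \sum_(n < N.+1) u n < M by rewrite ltNge; apply/negP/uM.
move/ltW => uM'; rewrite -ler_pdivrMl //; apply: le_trans uM'.
rewrite big_ord_recl mulr_sumr ler_wpDl ?balanced_prob_ge0 //.
by apply: ler_sum => n _; exact: balanced_prob_ge.
Qed.

Lemma empty_prob_dvg : (d <= 3)%N -> forall M, exists N, M <= \sum_(n < N) v n.
Proof.
move=> d3 M.
pose C := d%:R * ((1 + theta) / (1 - rho)).
have C_ge0 : 0 <= C.
  by rewrite mulr_ge0 // divr_ge0 ?subr_ge0 ?ltW // addr_gt0.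
have [L LC] : exists L, theta ^- L * C <= 2^-1.
  have [L CL] := expr_unbounded (C * 2) theta_gt1; exists L.
  by rewrite ler_pdivrMl ?exprn_gt0 // ler_pdivlMr.
pose c := mu drain ^+ L.
have c0 : 0 < c.
  rewrite exprn_gt0 //; apply: mulr_gt0; first exact: lt_trans p_lt_mbar.
  by apply: prodr_gt0 => i _; rewrite /= ffunE subr_gt0.
(* The factor 2 pays for the half of [\sum u] lost to queues longer than [L], and [c^-1] for the
   probability of [L] drain steps. *)
have [N uM] := balanced_prob_dvg d3 (2 * (c^-1 * `|M|)).
exists (N.+1 + L)%N.
have uM' : 2 * (c^-1 * `|M|) <= \sum_(n < N.+1) u n.
  by rewrite big_ord_recr /= (le_trans uM) // lerDl balanced_prob_ge0.
apply: le_trans (ler_norm M) _.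
apply: (@le_trans _ _ (\sum_(n < N.+1) v (n + L)%N)); last first.
  rewrite addnC big_split_ord /= ler_wpDl ?sumr_ge0 // => *.
    exact: empty_prob_ge0.
  by apply: ler_sum => n _; rewrite addnC.
apply: (@le_trans _ _
  (\sum_(n < N.+1) c * E n (fun h => (balanced_below L h)%:R))); last first.
  by apply: ler_sum => n _; exact: empty_prob_ge.
rewrite -mulr_sumr -ler_pdivrMl //.
have H : \sum_(n < N.+1) u n <= \sum_(n < N.+1) E n (fun h => (balanced_below L h)%:R)
    + theta ^- L * C * \sum_(n < N.+1) u n.
  apply: (@le_trans _ _ (\sum_(n < N.+1) (E n (fun h => (balanced_below L h)%:R) +
      theta ^- L * (d%:R * y n)))).
    by apply: ler_sum => n _; exact: balanced_prob_le.
  rewrite big_split lerD2l /= -!mulr_sumr -mulrA.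
  rewrite ler_wpM2l ?invr_ge0 ?exprn_ge0 ?(ltW theta_gt0) //.
  by rewrite -mulrA ler_wpM2l // sum_overload_bound.
have : theta ^- L * C * \sum_(n < N.+1) u n <= 2^-1 * \sum_(n < N.+1) u n.
  by rewrite ler_wpM2r ?sumr_ge0 // => n _; exact: balanced_prob_ge0.
move=> H'; have {H H'} := le_trans H (lerD (lexx _) H'); lra.
Qed.

Lemma empty_prob_small : (2 <= d)%N -> forall e, 0 < e ->
  exists K, forall n, (K <= n)%N -> v n <= e.
Proof.
move=> d2 e e0.
(* With energy at most [e ^+ 3 / 4], Nash's inequality bounds the maximal mass by [e]. *)
have e3 : 0 < e ^+ 3 / 4 by rewrite divr_gt0 ?exprn_gt0.
have [K HK] := summable_tail (sum_mass_energy p_gt0 p_lt1) e3.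
exists K => n Kn; apply: le_trans (empty_prob_le n) _.
apply: le_trans (balanced_prob_le_max p_gt0 p_lt1 n d2) _; rewrite expr1.
have m0 := max_mass_ge0 p_gt0 p_lt1 n.
rewrite -(@ler_pXn2r _ 3) ?nnegrE ?(ltW e0) //.
apply: le_trans (max_mass_energy p_gt0 p_lt1 n) _.
have := HK n.+1; rewrite big_nat_recr //= -ler_pdivlMl // mulrC.
apply: le_trans; rewrite lerDr sumr_ge0 // => j _; exact: mass_energy_ge0.
Qed.

(** With [d >= 4], three factors can be bounded by the maximal mass, whose cube is at most four
    times the summable energy. *)
Lemma empty_prob_summable : (4 <= d)%N -> exists C, forall N, \sum_(n < N) v n <= C.
Proof.
move=> d4; exists (4 * (p * (1 - p))^-1) => N.
apply: le_trans (ler_wpM2l _ (sum_mass_energy p_gt0 p_lt1 N)) => //.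
rewrite mulr_sumr; apply: ler_sum => n _; apply: le_trans (empty_prob_le n) _.
apply: le_trans (max_mass_energy p_gt0 p_lt1 n).
exact: balanced_prob_le_max.
Qed.

End Queues.

(** * From the probability space to histories *)

(** The integral of a nonnegative function is a supremum over simple functions below it, so it is
    monotone without measurability; this allows bounding the integral of the return time
    directly. *)
Lemma le_integral_nonmeasurable (disp : measure_display) (T : measurableType disp)
    (R : realType) (mu : {measure set T -> \bar R}) (f g : T -> \bar R) :
  (forall x, 0 <= f x)%E -> (forall x, f x <= g x)%E ->
  (\int[mu]_x f x <= \int[mu]_x g x)%E.
Proof.
move=> f0 fg; have g0 x : (0 <= g x)%E by exact: le_trans (fg x).
rewrite !ge0_integralTE //; apply: ereal_sup_le => _ [h hf <-].
by exists h => // x; exact: le_trans (fg x).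
Qed.

Section History.
Local Open Scope classical_set_scope.
Context (disp : measure_display) (T : measurableType disp) (R : realType).
Variables (P : probability T R) (d : nat) (p mbar : R).
Variables (a : nat -> 'I_d -> {RV P >-> bool}) (m : nat -> {RV P >-> bool}).

Definition outcome_at t w : outcome d := (m t w, [ffun i => a t i w]).

Definition history n w : seq (outcome d) :=
  [seq outcome_at t w | t <- rev (iota 0 n)].

Lemma historyS n w : history n.+1 w = outcome_at n w :: history n w.
Proof. by rewrite /history -addn1 iotaD rev_cat. Qed.

Lemma size_history n w : size (history n w) = n.
Proof. by rewrite size_map size_rev size_iota. Qed.

Lemma batch_history n w : batch a m (empty_queues d) n w = queues (history n w).
Proof.
elim: n => //= n IH; rewrite historyS /= -IH.
by apply/ffunP => i; rewrite !ffunE.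
Qed.

Lemma measurable_outcome_at t x : measurable [set w | outcome_at t w = x].
Proof.
have -> : [set w | outcome_at t w = x] =
    m t @^-1` [set x.1] `&` \bigcap_(i in [set: 'I_d]) (a t i @^-1` [set x.2 i]).
  apply/seteqP; split => w /=.
    by move=> <-; split => // i _ /=; rewrite ffunE.
  case=> mx ax; rewrite [x]surjective_pairing; congr (_, _) => //.
  by apply/ffunP => i; rewrite ffunE; exact: ax.
apply: measurableI; first exact: measurable_funPTI.
by apply: fin_bigcap_measurable => // i _; exact: measurable_funPTI.
Qed.

Lemma measurable_history n (A : set (seq (outcome d))) : measurable (history n @^-1` A).
Proof.
elim: n A => [|n IH] A.
  have [A0|A0] := pselect (A [::]).
    by rewrite (_ : _ @^-1` _ = setT) //; apply/seteqP; split => // w _.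
  by rewrite (_ : _ @^-1` _ = set0) //; apply/seteqP; split.
have -> : history n.+1 @^-1` A = \bigcup_(x in [set: outcome d])
    ([set w | outcome_at n w = x] `&` history n @^-1` [set h | A (x :: h)]).
  apply/seteqP; split => w /=; first by rewrite historyS => Aw; exists (outcome_at n w).
  by move=> [x _ [/= <-]]; rewrite historyS.
apply: fin_bigcup_measurable => // x _.
by apply: measurableI; [exact: measurable_outcome_at|exact: IH].
Qed.

Hypothesis a_bernoulli : forall t i, P [set w | a t i w = true] = p%:E.
Hypothesis m_bernoulli : forall t, P [set w | m t w = true] = mbar%:E.
Hypothesis am_indep : mutually_independent (arrivals_services a m).

Lemma prob_bernoulli (X : {RV P >-> bool}) c b :
  P [set w | X w = true] = c%:E -> P (X @^-1` [set b]) = (bernoulli_mass c b)%:E.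
Proof.
case: b => // PX.
have -> : X @^-1` [set false] = ~` [set w | X w = true].
  by apply/seteqP; split => w /=; case: (X w).
rewrite probability_setC ?PX //.
by have := @measurable_funPTI _ _ _ _ X [set true]; exact.
Qed.

(** Prescribing a whole history is an intersection of events on distinct arrival and service
    variables, to which mutual independence applies. *)
Lemma prob_history_eq g :
  P (history (size g) @^-1` [set g]) = (\prod_(x <- g) outcome_mass p mbar x)%:E.
Proof.
(* The outcome prescribed at time [t]; [g] is reversed because it lists the latest step first, and
   only times [t < size g] are read. *)
pose c t := nth (drain d) (rev g) t.
have gE : g = [seq c t | t <- rev (iota 0 (size g))].
  by rewrite map_rev -size_rev /c map_nth_iota0 // take_size revK.
pose os : seq (option 'I_d) := None :: [seq Some i | i <- index_enum 'I_d].
pose J := [seq (t, o) | t <- rev (iota 0 (size g)), o <- os].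
pose B (k : nat * option 'I_d) := [set if k.2 is Some i then (c k.1).2 i else (c k.1).1].
have -> : history (size g) @^-1` [set g] =
    \bigcap_(k in [set` J]) (arrivals_services a m k @^-1` B k).
  apply/seteqP; split => w /=.
    rewrite {2}gE => /eq_in_map hw [t o] /= /allpairsP[[t' o'] /= [t'g _ [-> ->]]].
    have := hw _ t'g; rewrite /arrivals_services /B /=.
    by case: o' => [i|] <- //=; rewrite ffunE.
  move=> H; rewrite [in RHS]gE; apply/eq_in_map => t tg.
  have Ht o : o \in os -> (arrivals_services a m (t, o) @^-1` B (t, o)) w.
    by move=> oo; apply: H; exact: allpairs_f.
  rewrite [c t]surjective_pairing; congr (_, _).
    by have := Ht None; apply; rewrite inE.
  apply/ffunP => i; rewrite ffunE; have := Ht (Some i); apply.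
  by rewrite inE /= map_f ?mem_index_enum.
rewrite am_indep //; last first.
  rewrite allpairs_uniq ?rev_uniq ?iota_uniq //=; last by move=> [? ?] [? ?].
  rewrite map_inj_uniq ?index_enum_uniq ?andbT; last exact: Some_inj.
  by apply/mapP => -[].
rewrite big_allpairs [in RHS]gE big_map -prodEFin; apply: eq_bigr => t _.
rewrite big_cons big_map EFinM -prodEFin; congr (_ * _)%E.
  exact: (prob_bernoulli (X := m t)).
by apply: eq_bigr => i _; exact: (prob_bernoulli (X := a t i)).
Qed.

(** Fixing the latest outcomes [g] makes induction on the number [n] of free earlier steps possible:
    the next earlier outcome is appended to [g]. *)
Lemma prob_history_prefix g n (Q : pred (seq (outcome d))) :
  P [set w | exists2 h, Q h & history (size g + n) w = g ++ h] =
  ((\prod_(x <- g) outcome_mass p mbar x) *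
   expect (outcome_mass p mbar) n (fun h => (Q h)%:R))%:E.
Proof.
elim: n g Q => [|n IH] g Q.
  rewrite addn0 /=; case: (boolP (Q [::])) => Q0.
    rewrite mulr1 -prob_history_eq; congr (P _); apply/seteqP; split => w /=.
      case=> -[|x h] _ E; first by rewrite /= E cats0.
      by have /(congr1 size) := E; rewrite size_history size_cat /=; lia.
    by move=> E; exists [::]; rewrite ?cats0.
  rewrite mulr0 (_ : [set w | _] = set0) ?measure0 //; apply/seteqP; split => // w /=.
  case=> h Qh /(congr1 size); rewrite size_history size_cat.
  by case: h Qh => [|? ?] /=; [rewrite (negbTE Q0)|lia].
pose F x := [set w | exists2 h,
  Q (x :: h) & history (size (rcons g x) + n) w = rcons g x ++ h].
pose D := [set` index_enum (outcome d)].
have -> : [set w | exists2 h, Q h & history (size g + n.+1) w = g ++ h] =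
    \bigcup_(x in D) F x.
  apply/seteqP; split => w /=.
    case=> -[|x h] Qh E.
      by have /(congr1 size) := E; rewrite cats0 size_history; lia.
    exists x; first by rewrite /D /= mem_index_enum.
    by exists h => //; rewrite size_rcons addSnnS E cat_rcons.
  case=> x _ [h Qh E]; exists (x :: h) => //.
  by rewrite -cat_rcons -E size_rcons addSnnS.
rewrite measure_fin_bigcup.
- rewrite -fsbig_seq ?index_enum_uniq //= mulr_sumr -sumEFin.
  apply: eq_bigr => x _; rewrite IH -cats1 big_cat big_seq1 /=; congr (_%:E).
  exact: esym (mulrA _ _ _).
- exact: finite_seq.
- move=> x y _ _ [w [[h _ E] [h' _]]]; rewrite !size_rcons in E *.
  rewrite E !cat_rcons => /eqP; rewrite eqseq_cat // eqxx /=.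
  by rewrite eqseq_cons => /andP[/eqP].
- move=> x _; rewrite /F.
  exact: (@measurable_history _
    [set h' | exists2 h, Q (x :: h) & h' = rcons g x ++ h]).
Qed.

Lemma prob_history n (Q : pred (seq (outcome d))) :
  P [set w | Q (history n w)] =
  (expect (outcome_mass p mbar) n (fun h => (Q h)%:R))%:E.
Proof.
have := prob_history_prefix [::] n Q; rewrite big_nil mul1r => <-.
by congr (P _); apply/seteqP; split => w /=; [exists (history n w)|case=> h ? ->].
Qed.

End History.

(** * Return time to the empty state *)

Section ReturnTime.
Local Open Scope classical_set_scope.
Local Open Scope ereal_scope.
Context (disp : measure_display) (T : measurableType disp) (R : realType).
Variables (P : probability T R) (d : nat) (p mbar : R).
Variables (a : nat -> 'I_d -> {RV P >-> bool}) (m : nat -> {RV P >-> bool}).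

Local Notation tau := (@return_time _ T R _ (batch a m) (empty_queues d)).

Definition not_returned n : set T := [set w | no_return (history a m n w)].

Lemma measurable_not_returned n : measurable (not_returned n).
Proof. exact: (@measurable_history _ _ _ _ _ _ _ n [set h | no_return h]). Qed.

Lemma not_returned_le k n w : (k <= n)%N -> not_returned n w -> not_returned k w.
Proof.
elim: n => [|n IH]; first by rewrite leqn0 => /eqP ->.
rewrite leq_eqVlt => /orP[/eqP-> //|kn]; rewrite /not_returned /= historyS /=.
by move=> /andP[+ _]; exact: IH.
Qed.

Lemma not_returned_neq t n w : (0 < t <= n)%N -> not_returned n w ->
  batch a m (empty_queues d) t w <> empty_queues d.
Proof.
move=> /andP[t0 tn] /(not_returned_le tn); case: t t0 {tn} => // t _.
rewrite /not_returned /= historyS => /andP[_ /negP nt] qt; apply: nt.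
by rewrite /is_empty -historyS -batch_history; apply/eqP.
Qed.

Lemma return_time_lty : [set w | tau w < +oo] = ~` \bigcap_n not_returned n.
Proof.
apply/seteqP; split => w /=.
  move=> /ereal_inf_lt[_ [t [t0 qt] <-] _] H.
  by apply: (@not_returned_neq t t w) qt; [rewrite t0 leqnn|exact: H].
move=> H; have [t t0 qt] : exists2 t, (0 < t)%N &
    batch a m (empty_queues d) t w = empty_queues d.
  apply: contrapT => noq; apply: H => n _; elim: n => [|n IH] //.
  rewrite /not_returned /= historyS /= IH /= -historyS.
  apply/negP => /eqP qn; apply: noq; exists n.+1 => //.
  by rewrite batch_history.
by apply: (@le_lt_trans _ _ t%:R%:E); [apply: ereal_inf_lbound; exists t|rewrite ltry].
Qed.

(** A return at time [t] leaves only the indices [j < t] as times of no return, so at most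
    [minn N t] indicators equal 1. *)
Lemma sum_not_returned_le N w : \sum_(j < N) (\1_(not_returned j) w)%:E <= tau w.
Proof.
apply: le_ereal_inf_tmp => _ [t [t0 qt] <-].
rewrite sumEFin lee_fin.
apply: (@le_trans _ _ (\sum_(j < N) (j < t)%N%:R)%R).
  apply: ler_sum => j _; rewrite indicE ler_nat; case: (ltnP j t) => jt; first exact: leq_b1.
  rewrite memNset // => H.
  by apply: (@not_returned_neq t j w) qt; rewrite ?t0 ?jt.
rewrite -natr_sum ler_nat.
suff -> : (\sum_(j < N) (j < t)%N = minn N t)%N by exact: geq_minr.
elim: N => [|N IH]; first by rewrite big_ord0 min0n.
by rewrite big_ord_recr IH /=; lia.
Qed.

Hypotheses (d_ge2 : (2 <= d)%N).
Hypotheses (p_gt0 : (0 < p)%R) (p_lt_mbar : (p < mbar)%R) (mbar_le1 : (mbar <= 1)%R).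
Hypothesis a_bernoulli : forall t i, P [set w | a t i w = true] = p%:E.
Hypothesis m_bernoulli : forall t, P [set w | m t w = true] = mbar%:E.
Hypothesis am_indep : mutually_independent (arrivals_services a m).

Local Notation r := (no_return_prob d p mbar).

Lemma prob_not_returned n : P (not_returned n) = (r n)%:E.
Proof. exact: (prob_history a_bernoulli m_bernoulli am_indep n (@no_return d)). Qed.

Lemma measurable_never_returned : measurable (\bigcap_n not_returned n).
Proof. by apply: bigcapT_measurable => n; exact: measurable_not_returned. Qed.

Lemma prob_return : P [set w | tau w < +oo] = 1 - P (\bigcap_n not_returned n).
Proof. by rewrite return_time_lty probability_setC //; exact: measurable_never_returned. Qed.

Lemma batch_recurrent : (d <= 3)%N -> recurrent P (batch a m) (empty_queues d).
Proof.
move=> d3; rewrite /recurrent prob_return.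
suff -> : P (\bigcap_n not_returned n) = 0 by rewrite sube0.
apply/eqP; rewrite eq_le measure_ge0 andbT; apply/lee_addgt0Pr => e e0.
have d0 := ltnW d_ge2.
have [n rn] := renewal_dvg (empty_prob_ge0 d p_gt0 p_lt_mbar mbar_le1)
  (no_return_prob_ge0 d p_gt0 p_lt_mbar mbar_le1)
  (no_return_prob_le d p_gt0 p_lt_mbar mbar_le1)
  (queues_renewal d p mbar) (empty_prob_dvg d0 p_gt0 p_lt_mbar mbar_le1 d3) e0.
rewrite add0e (@le_trans _ _ (r n)%:E) ?lee_fin // -prob_not_returned.
apply: le_measure; rewrite ?inE; [exact: measurable_never_returned
  |exact: measurable_not_returned|by move=> w; exact].
Qed.

Lemma batch_transient : (4 <= d)%N -> transient P (batch a m) (empty_queues d).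
Proof.
move=> d4; rewrite /transient prob_return.
have d0 := ltnW d_ge2.
have [C vC] := empty_prob_summable d0 p_gt0 p_lt_mbar mbar_le1 d4.
have [c c0 rc] := renewal_cvg (empty_prob_ge0 d p_gt0 p_lt_mbar mbar_le1)
  (no_return_prob_ge0 d p_gt0 p_lt_mbar mbar_le1)
  (no_return_prob_le d p_gt0 p_lt_mbar mbar_le1) (erefl _)
  (queues_renewal d p mbar) vC.
have cP : c%:E <= P (\bigcap_n not_returned n).
  (* Continuity from above: the probability of never returning is the limit of [r n], which stays
     above [c]. *)
  have cvgP : P \o not_returned @ \oo --> P (\bigcap_n not_returned n).
    apply: nonincreasing_cvg_mu.
    - by have := prob_not_returned 0; rewrite /= => ->; rewrite ltry.
    - exact: measurable_not_returned.
    - exact: measurable_never_returned.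
    - by move=> k n kn; apply/subsetPset => w; exact: not_returned_le.
  rewrite -(cvg_lim _ cvgP) //; apply: lime_ge; first by apply/cvg_ex; eexists; exact: cvgP.
  by near=> n; rewrite /= prob_not_returned lee_fin.
rewrite lteBlDr ?fin_num_measure //; last exact: measurable_never_returned.
by rewrite lteDl // (lt_le_trans _ cP) // lte_fin.
Unshelve. all: by end_near. Qed.

(** The mean return time is at least every partial sum of [r], and these are unbounded because [v]
    tends to 0. *)
Lemma batch_null : \int[P]_w tau w = +oo.
Proof.
have d0 := ltnW d_ge2.
apply/eqyP => M M0.
have [N rN] := renewal_null (empty_prob_ge0 d p_gt0 p_lt_mbar mbar_le1)
  (no_return_prob_ge0 d p_gt0 p_lt_mbar mbar_le1)
  (no_return_prob_le d p_gt0 p_lt_mbar mbar_le1) (erefl _)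
  (queues_renewal d p mbar)
  (empty_prob_small d0 p_gt0 p_lt_mbar mbar_le1 d_ge2) M.
apply: (@le_trans _ _ (\int[P]_w (\sum_(j < N) (\1_(not_returned j) w)%:E))); last first.
  apply: le_integral_nonmeasurable => w; last exact: sum_not_returned_le.
  by apply: sume_ge0 => j _; rewrite lee_fin.
rewrite ge0_integral_sum //.
- rewrite (eq_bigr (fun j : 'I_N => (r j)%:E)) ?sumEFin ?lee_fin // => j _.
  rewrite integral_indic //; last exact: measurable_not_returned.
  by rewrite setIT; exact: prob_not_returned.
- move=> j; apply/measurable_EFinP; apply: measurable_indic.
  exact: measurable_not_returned.
Qed.

End ReturnTime.

Local Open Scope classical_set_scope.
Local Open Scope ring_scope.
Local Open Scope ereal_scope.

Theorem theorem1 (disp : measure_display) (T : measurableType disp)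
    (R : realType) (P : probability T R) (d : nat) (p mbar : R)
    (a : nat -> 'I_d -> {RV P >-> bool}) (m : nat -> {RV P >-> bool})
    (d_ge2 : (2 <= d)%N)
    (p_gt0 : (0 < p)%R) (p_lt_mbar : (p < mbar)%R) (mbar_le1 : (mbar <= 1)%R)
    (a_bernoulli : forall t i, P [set w | a t i w = true] = p%:E)
    (m_bernoulli : forall t, P [set w | m t w = true] = mbar%:E)
    (am_indep : mutually_independent (arrivals_services a m)) :
  (d = 2%N \/ d = 3%N -> null_recurrent P (batch a m) (empty_queues d)) /\
  ((4 <= d)%N -> transient P (batch a m) (empty_queues d)).
Proof.
split=> [d23|d4]; last first.
  exact: (batch_transient d_ge2 p_gt0 p_lt_mbar mbar_le1 a_bernoulli m_bernoulli).
split; last first.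
  exact: (batch_null d_ge2 p_gt0 p_lt_mbar mbar_le1 a_bernoulli m_bernoulli).
apply: (batch_recurrent d_ge2 p_gt0 p_lt_mbar mbar_le1 a_bernoulli m_bernoulli) => //.
by case: d23 => ->.
Qed.
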